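(* Let $P_0,P_1$ be probability measures on $(\mathcal X,\mathcal B_{\mathcal X})$ with $P_1\ll P_0$ and $\mathrm{KL}(P_1\|P_0)<\infty$. Let $E:\mathcal X\to[0,\infty]$ be measurable with $\mathbb E_{P_0}[E]\le1$, $c:=\mathbb E_{P_1}[\log E]>0$ and $v:=\mathrm{Var}_{P_1}(\log E)<\infty$; let $W_t=\prod_{n\le t}E(X_n)$ be the i.i.d. product it generates; let $\alpha\in(0,1)$, $\ell=\log\frac1\alpha$, and suppose $c\,\ell>2v$. Then $$\bar\gamma_t(\alpha)\ \ge\ 1-\frac{2v}{c\,\ell}\qquad\text{for every }t\le\frac{\ell}{2c}.$$
   Context: $X_1,X_2,\dots$ are the coordinates on $\Omega=\mathcal X^{\mathbb N}$, $\mathbb P_1=P_1^{\otimes\mathbb N}$, $W_0=1$. $\tau_\alpha:=\inf\{t\in\mathbb N:W_t>\frac1\alpha\}$ ($\inf\emptyset=\infty$) and $\bar\gamma_t(\alpha):=\mathbb P_1(\tau_\alpha>t)$ for $t\in\mathbb N_0$. *)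

(* Defs.v *)
From HB Require Import structures.
From mathcomp Require Import all_boot all_order all_algebra.
From mathcomp Require Import all_classical all_reals all_analysis.
From mathcomp Require Import measurable_realfun.

Set Implicit Arguments.
Unset Strict Implicit.
Unset Printing Implicit Defensive.

Import Order.TTheory GRing.Theory Num.Theory.

Local Open Scope classical_set_scope.
Local Open Scope ring_scope.
Local Open Scope charge_scope.
Local Open Scope ereal_scope.

(* Indices are shifted by one: the coordinate written X_n on paper (n >= 1)
   is [fun w => w n.-1]. *)
Definition coordinate_sets d (T : measurableType d) : set (set (nat -> T)) :=
  \bigcup_n preimage_set_system setT (fun w : nat -> T => w n) measurable.
Arguments coordinate_sets {d} T _.

(* The sequence space T^nat with the product sigma-algebra, i.e. the one
   generated by the coordinates. *)
Notation seqspace T := (g_sigma_algebraType (coordinate_sets T)).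

(* The defining property of the countable power P^{\otimes nat}; by
   Dynkin's pi-lambda theorem it determines PP. *)
Definition is_infinite_power d (T : measurableType d) (R : realType)
    (P : probability T R) (PP : probability (seqspace T) R) : Prop :=
  forall (n : nat) (A : nat -> set T), (forall i, measurable (A i)) ->
    PP [set w | forall i, (i < n)%N -> A i (w i)] = \prod_(i < n) P (A i).

(* Kullback-Leibler divergence KL(P || Q), in [0, +oo]. The negative part of
   log(dP/dQ) is always P-integrable, so the integral is well defined. *)
Definition KL d (T : measurableType d) (R : realType)
    (P Q : probability T R) : \bar R :=
  if `[< P `<< Q >]
  then \int[P]_x lne (('d (charge_of_finite_measure P) '/d Q) x)
  else +oo.

(* The library's 'E_P[_] and 'V_P[_] only take R-valued functions, whereas
   log E may take the values -oo and +oo. If the positive and the negative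
   part of Y both have infinite integral, then [emean P Y] is -oo. *)
Definition emean d (T : measurableType d) (R : realType)
    (P : probability T R) (Y : T -> \bar R) : \bar R := \int[P]_x Y x.

Definition evariance d (T : measurableType d) (R : realType)
    (P : probability T R) (Y : T -> \bar R) : \bar R :=
  emean P (fun x => (Y x - emean P Y) ^+ 2).

Definition wealth (T : Type) (R : realType) (E : T -> \bar R)
    (t : nat) (w : nat -> T) : \bar R := \prod_(n < t) E (w n).

(* First time t >= 1 with W_t > 1 / alpha; [ereal_inf set0] is +oo. *)
Definition crossing_time (T : Type) (R : realType) (E : T -> \bar R)
    (alpha : R) (w : nat -> T) : \bar R :=
  ereal_inf [set t%:R%:E | t in
    [set t : nat | (0 < t)%N /\ (alpha^-1)%:E < wealth E t w]].

Definition not_crossed_prob d (T : measurableType d) (R : realType)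
    (PP : probability (seqspace T) R) (E : T -> \bar R) (alpha : R)
    (t : nat) : \bar R :=
  PP [set w | t%:R%:E < crossing_time E alpha w].

(* Main.v *)
(* Kolmogorov's maximal inequality for the centred walk
   S_k = \sum_(i < k) (log E(X_i) - c). If W_k > 1/alpha for some k <= t, then
   S_k > ell - t c >= ell / 2, which has probability at most
   t v / (ell / 2)^2 <= 2 v / (c ell). The maximal inequality is proved by
   induction on the horizon, for walks with an arbitrary starting point s, in
   the form P(s + S_k > a for some k <= n) <= (s^2 + n v) / a^2: conditioning
   on the first step replaces s by s + Z, and E (s + Z)^2 = s^2 + v. *)

Require Import Defs.
From HB Require Import structures.
From mathcomp Require Import all_boot all_order all_algebra.
From mathcomp Require Import all_classical all_reals all_analysis.
From mathcomp Require Import measurable_realfun.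
From mathcomp Require Import lra ring.

Set Implicit Arguments.
Unset Strict Implicit.
Unset Printing Implicit Defensive.

Import Order.TTheory GRing.Theory Num.Theory.

Local Open Scope classical_set_scope.
Local Open Scope ring_scope.
Local Open Scope ereal_scope.

(** * Measurability of the logarithm and in the sequence space *)

Lemma measurable_lne (R : realType) : measurable_fun setT (@lne R).
Proof.
move=> mD; apply: (measurability _ (ErealGenOInfty.measurableE R)) => //.
move=> /= _ [_ [r ->]] <-; rewrite setTI.
(* [lne] is -oo at nonpositive arguments, so the preimage of an upper ray is again an upper ray,
   with a positive end point. *)
rewrite (_ : _ @^-1` _ = `](expeR r%:E), +oo[%classic).
  exact: emeasurable_itv.
apply/seteqP; split => y /=; rewrite !in_itv/= !andbT.
  case: y => [y| |] //=; last by rewrite !ltry.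
  case: ifPn => //; rewrite -ltNge => y0.
  by rewrite !lte_fin -ltr_expR lnK.
case: y => [y| |] //=; rewrite ?ltry ?lte_fin // => ry.
have y0 : (0 < y)%R by exact: lt_trans (expR_gt0 r) ry.
by rewrite leNgt y0/= lte_fin -ltr_expR lnK.
Qed.

Lemma measurable_coordinate d (T : measurableType d) (n : nat) :
  measurable_fun setT (fun w : seqspace T => w n).
Proof.
move=> _ A mA; rewrite setTI; apply: sub_sigma_algebra.
by exists n => //; exists A => //; rewrite setTI.
Qed.

Lemma measurable_seqspace d d' (T : measurableType d) (S : measurableType d')
    (f : S -> seqspace T) :
  (forall n, measurable_fun setT (fun x => f x n)) -> measurable_fun setT f.
Proof.
move=> mf.
apply: (@measurability _ _ _ (seqspace T) _ _ (coordinate_sets T)) => //.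
move=> _ [_ [n _ [A mA <-]] <-]; rewrite !setTI -comp_preimage.
by rewrite -[X in measurable X]setTI; exact: mf.
Qed.

Definition seq_cons d (T : measurableType d) (p : T * seqspace T) :
  seqspace T := fun n => if n is m.+1 then p.2 m else p.1.

Lemma measurable_seq_cons d (T : measurableType d) :
  measurable_fun setT (@seq_cons d T).
Proof.
apply: measurable_seqspace => -[|n] /=; first exact: measurable_fst.
exact: measurableT_comp (measurable_coordinate n) measurable_snd.
Qed.

Definition cylinder (T : Type) (n : nat) (A : nat -> set T) : set (nat -> T) :=
  [set w | forall i, (i < n)%N -> A i (w i)].

Lemma measurable_cylinder d (T : measurableType d) n (A : nat -> set T) :
  (forall i, measurable (A i)) ->
  measurable (cylinder n A : set (seqspace T)).
Proof.
move=> mA.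
rewrite (_ : cylinder n A = \bigcap_(i in `I_n) (fun w => w i) @^-1` (A i)) //.
apply: fin_bigcap_measurable => //= i _.
by rewrite -[X in measurable X]setTI; exact: measurable_coordinate.
Qed.

(** The pi-system on which [is_infinite_power] prescribes the measure. *)
Definition cylinders d (T : measurableType d) : set (set (seqspace T)) :=
  [set B | exists n (A : nat -> set T),
     (forall i, measurable (A i)) /\ B = cylinder n A].

Lemma cylinders_setI d (T : measurableType d) : setI_closed (@cylinders d T).
Proof.
move=> _ _ [m [A [mA ->]]] [n [B [mB ->]]].
(* Each cylinder is padded with [setT] beyond its own length. *)
exists (maxn m n), (fun i => (if (i < m)%N then A i else setT) `&`
                            (if (i < n)%N then B i else setT)); split.
  by move=> i; apply: measurableI; case: ifP.
apply/seteqP; split => w /=.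
  move=> [Aw Bw] i _; split; case: ifP => //; [exact: Aw | exact: Bw].
move=> ABw; split => i im.
  by have [] := ABw i; rewrite ?leq_max ?im.
by have [] := ABw i; rewrite ?leq_max ?im ?orbT.
Qed.

Lemma measurable_cylindersE d (T : measurableType d) :
  @measurable _ (seqspace T) = <<s @cylinders d T >>.
Proof.
apply/seteqP; split; last first.
  apply: smallest_sub; first exact: sigma_algebra_measurable.
  by move=> _ [n [A [mA ->]]]; exact: measurable_cylinder.
apply: smallest_sub; first exact: smallest_sigma_algebra.
move=> _ [n _ [A mA <-]]; apply: sub_sigma_algebra.
exists n.+1, (fun i => if i == n then A else setT); split.
  by move=> i; case: ifP.
rewrite setTI; apply/seteqP; split => w /=.
  by move=> Aw i _; case: ifP => // /eqP ->.
by move=> /(_ n (ltnSn n)); rewrite eqxx.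
Qed.

(** * Splitting off the first coordinate *)

Section infinite_power.
Context d (T : measurableType d) (R : realType).
Variables (P : probability T R) (PP : probability (seqspace T) R).
Hypothesis PPE : is_infinite_power P PP.

(** This is the conditioning on the first step. [PP] and the image of [P \x PP] under [seq_cons]
    agree on cylinders, hence on all measurable sets; the product measure then integrates over
    sections. *)
Lemma infinite_power_cons (B : set (seqspace T)) : measurable B ->
  PP B = \int[P]_x PP [set w | B (seq_cons (x, w))].
Proof.
move=> mB.
pose cons_mfun := mfun_Sub (mem_set (@measurable_seq_cons d T)).
transitivity (pushforward (P \x PP) cons_mfun B).
  apply: (measure_unique (@cylinders d T) (fun=> setT)) => //.
  - exact: measurable_cylindersE.
  - exact: cylinders_setI.
  - by move=> _; exists 0%N, (fun=> setT); split => //; apply/seteqP; split.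
  - by rewrite bigcup_const.
  - move=> _ [[|n] [A [mA ->]]].
      rewrite (_ : cylinder 0 A = setT); last by apply/seteqP; split.
      by transitivity (1%E : \bar R); [|symmetry]; exact: probability_setT.
    transitivity (\prod_(i < n.+1) P (A i)); first exact: PPE.
    transitivity ((P \x PP) (A 0%N `*` cylinder n (A \o succn))).
      rewrite product_measure1E//; last first.
        by apply: measurable_cylinder => i; exact: mA.
      rewrite big_ord_recl; congr (_ * _); symmetry; apply: PPE => i; exact: mA.
    congr ((P \x PP) _).
    apply/seteqP; split => -[x w] /=.
      by move=> [xA wA] [|i] //= ni; exact: wA.
    by move=> xw; split=> [|i ni]; [exact: (xw 0%N) | exact: (xw i.+1)].
  - by move=> k; rewrite (le_lt_trans (probability_le1 _ _)) ?ltry.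
by apply: eq_integral => x _ /=; rewrite xsectionE.
Qed.

End infinite_power.

(** * Kolmogorov's maximal inequality *)

Section maximal_inequality.
Context d (T : measurableType d) (R : realType).
Variables (P : probability T R) (PP : probability (seqspace T) R).
Hypothesis PPE : is_infinite_power P PP.
Variable Z : T -> R.
Hypothesis mZ : measurable_fun setT Z.

(** Index [k] stands for time [k.+1]. The starting value [s] is not tested, so horizon 0 gives the
    empty event on which the induction starts. *)
Definition exceedance (a : R) (n : nat) (s : R) : set (seqspace T) :=
  [set w : nat -> T | exists2 k, (k < n)%N &
    (a < s + \sum_(i < k.+1) Z (w i))%R].

Lemma measurable_exceedance a n s : measurable (exceedance a n s).
Proof.
rewrite (_ : exceedance a n s = \bigcup_(k in `I_n)
    (fun w : seqspace T => (s + \sum_(i < k.+1) Z (w i))%R)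
      @^-1` `]a, +oo[%classic).
  apply: bigcup_measurable => k _.
  rewrite -[X in measurable X]setTI.
  apply: measurable_funD => //; apply: measurable_sum => i.
  exact: measurableT_comp mZ (measurable_coordinate i).
by apply/seteqP; split => w [k kn] /=; rewrite ?in_itv/= ?andbT;
  exists k => //=; rewrite ?in_itv/= ?andbT.
Qed.

Lemma exceedance_cons a n s x w :
  exceedance a n.+1 s (seq_cons (x, w)) ->
  (a < s + Z x)%R \/ exceedance a n (s + Z x)%R w.
Proof.
move=> [[|k] kn]; first by rewrite big_ord1; left.
by rewrite big_ord_recl/= addrA; right; exists k.
Qed.

Variable v : R.
Hypothesis iZ : P.-integrable setT (EFin \o Z).
Hypothesis Z0 : \int[P]_x (Z x)%:E = 0.
Hypothesis Zv : \int[P]_x (Z x ^+ 2)%:E = v%:E.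

(** Serves to average the expanded square of [s + Z x]: the linear term vanishes because [Z] is
    centred. *)
Lemma integral_quadratic (a b c : R) :
  \int[P]_x (a + b * Z x + c * Z x ^+ 2)%:E = (a + c * v)%:E.
Proof.
have iZ2 : P.-integrable setT (fun x => (Z x ^+ 2)%:E).
  apply/integrableP; split.
    by apply/measurable_EFinP; exact: measurable_funX.
  under eq_integral do rewrite gee0_abs ?lee_fin ?sqr_ge0//.
  by rewrite Zv ltry.
have ib : P.-integrable setT (fun x => b%:E * (Z x)%:E) by exact: integrableZl.
have ic : P.-integrable setT (fun x => c%:E * (Z x ^+ 2)%:E).
  exact: integrableZl.
have ia : P.-integrable setT (cst a%:E : T -> \bar R).
  exact: finite_measure_integrable_cst.
under eq_integral do rewrite !EFinD !EFinM.
rewrite integralD//; last exact: integrableD.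
rewrite integralD//= !integralZl// Z0 Zv mule0 adde0 integral_cst//.
rewrite EFinD EFinM; congr (_ + _); rewrite -[RHS]mule1; congr (_ * _).
exact: probability_setT.
Qed.

Lemma exceedance_le a n s : (0 < a)%R ->
  PP (exceedance a n s) <= ((s ^+ 2 + n%:R * v) / a ^+ 2)%:E.
Proof.
move=> a0; have a20 : (0 < a ^+ 2)%R by rewrite exprn_gt0.
have v0 : (0 <= v)%R.
  rewrite -lee_fin -Zv; apply: integral_ge0 => x _.
  by rewrite lee_fin sqr_ge0.
elim: n s => [|n IH] s.
  rewrite (_ : exceedance a 0 s = set0); last by apply/seteqP; split => w [].
  by rewrite measure0 mul0r addr0 lee_fin divr_ge0 ?sqr_ge0.
rewrite (infinite_power_cons PPE); last exact: measurable_exceedance.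
(* The bound for horizon [n.+1] from [s] is the mean of the bound for horizon [n] from [s + Z x], so
   a comparison for each [x] suffices. *)
have -> : ((s ^+ 2 + n.+1%:R * v) / a ^+ 2)%:E =
    \int[P]_x (((s + Z x) ^+ 2 + n%:R * v) / a ^+ 2)%:E.
  transitivity (\int[P]_x ((s ^+ 2 + n%:R * v) / a ^+ 2 +
      (2 * s / a ^+ 2) * Z x + (a ^+ 2)^-1 * Z x ^+ 2)%:E).
    rewrite integral_quadratic; congr EFin; rewrite -natr1; field.
    by rewrite gt_eqF.
  apply: eq_integral => x _; congr EFin; field.
  by rewrite gt_eqF.
apply: ge0_le_integral => //.
- have mB := @measurable_seq_cons _ T _ _ (measurable_exceedance a n.+1 s).
  have := measurable_fun_xsection PP (mB measurableT).
  by apply: eq_measurable_fun => x _ /=; rewrite setTI xsectionE.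
- apply/measurable_EFinP; apply: measurable_funM => //.
  apply: measurable_funD => //; apply: measurable_funX.
  exact: measurable_funD.
move=> x _.
have mC : measurable [set w | exceedance a n.+1 s (seq_cons (x, w))].
  rewrite -[X in measurable X]setTI.
  apply: (measurable_fun_pair2 x (@measurable_seq_cons _ T)) => //.
  exact: measurable_exceedance.
(* If the first step already exceeds [a], the right-hand side is at least 1; otherwise the remaining
   walk has to exceed [a]. *)
have [asZ|asZ] := ltP a (s + Z x)%R.
  apply: (@le_trans _ _ 1); first exact: probability_le1.
  rewrite lee_fin ler_pdivlMr// mul1r.
  rewrite (@le_trans _ _ ((s + Z x) ^+ 2)%R)//.
    by rewrite lerXn2r ?nnegrE// ltW// (lt_trans a0).
  by rewrite lerDl mulr_ge0.
apply: le_trans (IH _); apply: le_measure; rewrite ?inE.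
- exact: mC.
- exact: measurable_exceedance.
move=> w /= /exceedance_cons[|//].
by rewrite ltNge asZ.
Qed.

End maximal_inequality.

(** * The crossing time and the wealth as an exponential *)

Lemma lt_crossing_time (T : Type) (R : realType) (E : T -> \bar R) (alpha : R)
    (w : nat -> T) (t : nat) :
  (t%:R%:E < crossing_time E alpha w) <->
  (forall k, (0 < k <= t)%N -> wealth E k w <= (alpha^-1)%:E).
Proof.
split=> [tE k /andP[k0 kt]|wE].
  rewrite leNgt; apply/negP => Ek; move: tE; rewrite ltNge => /negP; apply.
  apply: (@le_trans _ _ k%:R%:E); last by rewrite lee_fin ler_nat.
  by apply: ereal_inf_lbound; exists k.
(* Crossing times are integers, so the bound [t.+1] passes to the infimum and keeps the inequality
   strict, also when there is no crossing. *)
apply: (@lt_le_trans _ _ t.+1%:R%:E); first by rewrite lte_fin ltr_nat.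
apply: le_ereal_inf_tmp => _ [k [k0 Ek] <-]; rewrite lee_fin ler_nat ltnNge.
by apply/negP => kt; move: Ek; rewrite ltNge wE// k0.
Qed.

Lemma measurable_lt_crossing_time d (T : measurableType d) (R : realType)
    (E : T -> \bar R) (alpha : R) (t : nat) : measurable_fun setT E ->
  measurable [set w : seqspace T | t%:R%:E < crossing_time E alpha w].
Proof.
move=> mE.
have mW k : measurable_fun setT (fun w : seqspace T => wealth E k w).
  elim: k => [|k IH].
    rewrite (_ : (fun _ => _) = cst 1) //.
    by apply/funext => w; rewrite /wealth big_ord0.
  rewrite (_ : (fun _ => _) = (fun w => wealth E k w * E (w k))).
    apply: emeasurable_funM => //.
    exact: measurableT_comp mE (measurable_coordinate k).
  by apply/funext => w; rewrite /wealth big_ord_recr.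
rewrite (_ : [set _ | _] = \bigcap_(k in [set k | (0 < k <= t)%N])
    [set w : seqspace T | wealth E k w <= (alpha^-1)%:E]).
  apply: bigcap_measurableType => k _; rewrite -[X in measurable X]setTI.
  exact: emeasurable_fun_infty_c.
by apply/seteqP; split => w /=; [move/lt_crossing_time|
  move=> h; apply/lt_crossing_time].
Qed.

(** Finite logarithms rule out the factors 0 and +oo, so [fine] loses nothing. *)
Lemma wealth_expR (T : Type) (R : realType) (E : T -> \bar R) (k : nat)
    (w : nat -> T) :
  (forall i, (i < k)%N -> 0 <= E (w i) /\ lne (E (w i)) \is a fin_num) ->
  wealth E k w = (expR (\sum_(i < k) fine (lne (E (w i)))))%:E.
Proof.
move=> Ew; rewrite expR_sum -prodEFin; apply: eq_bigr => i _.
have [E0 Ef] := Ew i (ltn_ord i).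
by rewrite -[in LHS](@lneK _ (E (w i))) ?in_itv/= ?E0 ?leey// -(fineK Ef).
Qed.

(** * Finiteness and centring of the logarithm *)

Section centered_log.
Context d (T : measurableType d) (R : realType) (P : probability T R).
Variable Y : T -> \bar R.
Hypothesis mY : measurable_fun setT Y.
Hypothesis Ygt0 : 0 < emean P Y.
Hypothesis Yvar : evariance P Y < +oo.

(** If the mean were +oo, the difference [Y x - emean P Y] would be -oo everywhere, since +oo - +oo
    is -oo here, and the variance would be +oo. *)
Lemma emean_fin_num : emean P Y \is a fin_num.
Proof.
rewrite fin_numE gt_eqF ?(lt_trans _ Ygt0) ?ltNyr//=.
apply/eqP => Yoo; move: Yvar; rewrite /evariance Yoo /emean.
rewrite (_ : (fun x => _) = cst +oo); last first.
  by apply/funext => x; case: (Y x).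
by rewrite integral_cst//= [X in _ * X]probability_setT mule1 ltxx.
Qed.

(** A real-valued step, as the maximal inequality requires. It differs from [Y x - emean P Y] only
    where [Y] is infinite, a null set. *)
Let Z x := (fine (Y x) - fine (emean P Y))%R.

Lemma measurable_centered : measurable_fun setT Z.
Proof.
apply: measurable_funB => //.
exact: measurableT_comp (fine_measurable measurableT) mY.
Qed.

Let sq_Y : P.-integrable setT (fun x => (Y x - emean P Y) ^+ 2).
Proof.
apply/integrableP; split.
  have mYc : measurable_fun setT (fun x => Y x - emean P Y).
    exact: emeasurable_funB.
  exact: emeasurable_funM.
under eq_integral do rewrite gee0_abs ?sqre_ge0//.
exact: Yvar.
Qed.

(** The mean is finite, so an infinite [Y x] has an infinite squared deviation; an integrable
    function is infinite only on a null set. *)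
Lemma ae_fin_num : {ae P, forall x, Y x \is a fin_num}.
Proof.
have := integrable_ae measurableT sq_Y.
apply: filterS => x /(_ I); have := emean_fin_num.
by case: (emean P Y) => // c _; case: (Y x).
Qed.

Lemma evariance_centered :
  \int[P]_x (Z x ^+ 2)%:E = evariance P Y.
Proof.
rewrite /evariance {1}/emean; apply: ae_eq_integral => //.
- exact/measurable_EFinP/measurable_funX/measurable_centered.
- exact: measurable_int sq_Y.
apply: filterS ae_fin_num => x Yx _.
by rewrite /Z EFin_expe EFinB !fineK// emean_fin_num.
Qed.

(** Dominated by 1 + Z^2, which is integrable under a probability measure. *)
Lemma integrable_centered : P.-integrable setT (EFin \o Z).
Proof.
have iZ2 : P.-integrable setT (fun x => (Z x ^+ 2)%:E).
  apply/integrableP; split.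
    exact/measurable_EFinP/measurable_funX/measurable_centered.
  under eq_integral do rewrite gee0_abs ?lee_fin ?sqr_ge0//.
  by rewrite evariance_centered.
have i1 : P.-integrable setT (cst 1 : T -> \bar R).
  exact: finite_measure_integrable_cst.
apply: (le_integrable measurableT _ _ (integrableD measurableT i1 iZ2)).
  exact/measurable_EFinP/measurable_centered.
move=> x _ /=; rewrite lee_fin [leRHS]ger0_norm; last first.
  by rewrite addr_ge0// sqr_ge0.
rewrite -real_normK ?num_real//; have := normr_ge0 (Z x); nra.
Qed.

(** Almost everywhere [Y] is [Z] plus its mean; integrating, the finite mean cancels. *)
Lemma integral_centered : \int[P]_x (Z x)%:E = 0.
Proof.
have := emean_fin_num.
have : emean P Y = \int[P]_x ((Z x)%:E + (fine (emean P Y))%:E).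
  rewrite {1}/emean; apply: ae_eq_integral => //.
    apply: emeasurable_funD => //.
    exact/measurable_EFinP/measurable_centered.
  apply: filterS ae_fin_num => x Yx _.
  by rewrite /Z -EFinD subrK fineK.
rewrite integralD//; [|exact: integrable_centered|]; last first.
  exact: finite_measure_integrable_cst.
rewrite integral_cst// [X in _ * X]probability_setT mule1.
have := integrable_fin_num measurableT integrable_centered.
rewrite /=; case: (\int[P]_x _) => // z _; case: (emean P Y) => // c /=.
by move=> [] cE _; congr EFin; lra.
Qed.

End centered_log.

(* [c] and [v] are extended reals; [0 < c] and [v < +oo] force both to be
   finite, so that [fine] loses nothing. *)
Theorem lemma5p10 (R : realType) (d : measure_display) (X : measurableType d)
    (P0 P1 : probability X R) (PP1 : probability (seqspace X) R)
    (E : X -> \bar R) (alpha : R) :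
  is_infinite_power P1 PP1 ->
  P1 `<< P0 ->
  KL P1 P0 < +oo ->
  measurable_fun setT E ->
  (forall x, 0 <= E x) ->
  emean P0 E <= 1 ->
  let c := emean P1 (fun x => lne (E x)) in
  let v := evariance P1 (fun x => lne (E x)) in
  0 < c ->
  v < +oo ->
  (0 < alpha < 1)%R ->
  let ell := ln (1 / alpha)%R in
  2%:E * v < c * ell%:E ->
  forall t : nat, (t%:R <= ell / (2 * fine c))%R ->
    (1 - 2 * fine v / (fine c * ell))%:E <= not_crossed_prob PP1 E alpha t.
Proof.
move=> PPE _ _ mE E0 _ c v c0 vlty /andP[alpha0 alpha1] ell _ t tle.
pose Y x := lne (E x).
have mY : measurable_fun setT Y.
  exact: measurableT_comp (@measurable_lne R) mE.
have cfin : c \is a fin_num := emean_fin_num c0 vlty.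
pose Z x := (fine (Y x) - fine c)%R.
have mZ : measurable_fun setT Z by exact: measurable_centered.
have v0 : 0 <= v by apply: integral_ge0 => x _; exact: sqre_ge0.
have Zv : \int[P1]_x (Z x ^+ 2)%:E = (fine v)%:E.
  by rewrite fineK ?ge0_fin_numE// evariance_centered.
have fc0 : (0 < fine c)%R by rewrite fine_gt0// c0 ltey_eq cfin.
have fv0 : (0 <= fine v)%R by exact: fine_ge0.
have ell0 : (0 < ell)%R by rewrite ln_gt0// div1r invf_gt1.
(* A crossing at time k <= t puts the centred walk above ell - k c, which is at least [a] as c > 0.
   The condition on [t] says t c <= ell / 2, whence a >= ell / 2. *)
pose a := (ell - t%:R * fine c)%R.
have ella : (ell / 2 <= a)%R.
  move: tle; rewrite ler_pdivlMr ?mulr_gt0// /a; lra.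
have a0 : (0 < a)%R by rewrite (lt_le_trans _ ella)// divr_gt0.
pose S : set (seqspace X) := [set w | t%:R%:E < crossing_time E alpha w].
have mS : measurable S by exact: measurable_lt_crossing_time.
(* The exponential form of the wealth needs finite logarithms; the event [C] secures them for the
   first [t] factors and has probability 1. *)
pose F := [set x | Y x \is a fin_num].
have mF : measurable F.
  by rewrite -[F]setTI; exact: emeasurable_fin_num.
have PF : P1 F = 1.
  have PFC : P1 (~` F) = 0.
    by apply/negligibleP; [exact: measurableC | exact: (ae_fin_num mY c0 vlty)].
  have := probability_setC P1 (measurableC mF).
  by rewrite setCK => ->; rewrite [X in _ - X]PFC sube0.
pose C : set (seqspace X) := cylinder t (fun=> F).
have mC : measurable C by exact: measurable_cylinder.
have PC : PP1 C = 1.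
  transitivity (\prod_(i < t) P1 F); first exact: PPE.
  by apply: big1 => i _; exact: PF.
have mB := measurable_exceedance mZ a t 0.
have CBS : C `\` exceedance Z a t 0 `<=` S.
  move=> w [Cw Bw]; apply/lt_crossing_time => k /andP[k0 kt].
  rewrite wealth_expR; last first.
    by move=> i ik; split => //; exact: Cw (leq_trans ik kt).
  (* Time [k] has index [k.-1] in [exceedance]. *)
  rewrite lee_fin leNgt; apply/negP => ltW; apply: Bw; exists k.-1.
    by rewrite prednK.
  rewrite prednK// add0r sumrB sumr_const card_ord -mulr_natl /a.
  have : (ell < \sum_(i < k) fine (Y (w i)))%R.
    by rewrite -ltr_expR lnK ?div1r// posrE invr_gt0.
  have : (k%:R * fine c <= t%:R * fine c)%R by rewrite ler_pM2r// ler_nat.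
  rewrite /Y; lra.
apply: (@le_trans _ _ (PP1 (C `\` exceedance Z a t 0))); last first.
  by apply: le_measure; rewrite ?inE//; exact: measurableD.
have PB := exceedance_le PPE mZ (integrable_centered mY c0 vlty)
  (integral_centered mY c0 vlty) Zv t 0 a0.
(* Since [C] has probability 1, removing the exceedance event costs at most the probability of that
   event. *)
rewrite measureD//; last by rewrite [X in X < _]PC ltry.
rewrite [X in _ <= X - _]PC EFinB; apply: leeB => //.
apply: (@le_trans _ _ (PP1 (exceedance Z a t 0))).
  by apply: le_measure; rewrite ?inE//; exact: measurableI.
apply: le_trans PB _; rewrite lee_fin expr0n/= add0r.
(* Insert t <= ell / (2 c) in the numerator and a >= ell / 2 in the denominator; the result
   simplifies to 2 v / (c ell). *)
apply: (@le_trans _ _ (ell / (2 * fine c) * fine v / (ell / 2) ^+ 2)%R).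
  apply: ler_pM; rewrite ?mulr_ge0 ?invr_ge0 ?sqr_ge0//.
    by rewrite ler_wpM2r.
  have h0 : (0 < ell / 2)%R by rewrite divr_gt0.
  by rewrite lef_pV2 ?posrE ?exprn_gt0// lerXn2r ?nnegrE ?(ltW a0) ?(ltW h0).
rewrite le_eqVlt; apply/orP; left; apply/eqP; field.
by rewrite !gt_eqF.
Qed.
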